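(* For all integers $k \ge r \ge 3$, \[ sat(n,k,r) = \alpha(k,r)\,n + o(n) \quad \text{as } n \to \infty. \]
   Context: All graphs are finite and simple. A $k$-partite graph comes with a fixed partition of its vertex set into $k$ parts (parts may have arbitrary sizes). An edge or non-edge $uv$ is admissible if $u$ and $v$ lie in different parts. A $k$-partite graph is $K_r$-partite-saturated if it contains no $K_r$ but adding any admissible non-edge creates a copy of $K_r$. $sat(n,k,r)$ is the minimum number of edges of a $K_r$-partite-saturated $k$-partite graph with exactly $n$ vertices in each of its $k$ parts. $\alpha(k,r)$ is the minimum of $e(X, V(G)\setminus X)$ (number of edges between $X$ and its complement) over all pairs $(G,X)$ where $G$ is a $K_r$-partite-saturated $k$-partite graph and $X$ is an independent set of $G$ of size $k$ containing exactly one vertex from each part of $G$. *)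

(* Defs.v *)
From mathcomp Require Import all_boot boolp.
Set Implicit Arguments.
Unset Strict Implicit.
Unset Printing Implicit Defensive.

(* Irreflexivity of [adj] follows from [adj_part]. Parts may be empty. *)
Record kgraph (k : nat) := KGraph {
  vertex :> finType;
  part : vertex -> 'I_k;
  adj : rel vertex;
  adj_sym : symmetric adj;
  adj_part : forall u v, adj u v -> part u != part v
}.

Section Graphs.
Variable V : finType.
Implicit Types (e : rel V) (A X : {set V}).

Definition edges e : {set {set V}} :=
  [set [set p.1; p.2] | p : V * V & e p.1 p.2].

Definition cut_edges e X : {set {set V}} :=
  [set E in edges e | (E :&: X != finset.set0) && (E :&: ~: X != finset.set0)].

Definition clique e A := [forall u in A, forall v in A, (u != v) ==> e u v].

Definition has_K e (r : nat) := [exists A : {set V}, (#|A| == r) && clique e A].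

Definition independent e X := [forall u in X, forall v in X, ~~ e u v].

Definition add_edge e (u v : V) : rel V := fun x y =>
  [|| e x y, (x == u) && (y == v) | (x == v) && (y == u)].
End Graphs.

Section PartiteGraphs.
Variable k : nat.
Implicit Type G : kgraph k.

Definition part_set G (i : 'I_k) : {set G} := [set v | part v == i].

Definition admissible G (u v : G) := part u != part v.

Definition partite_saturated G (r : nat) :=
  ~~ has_K (@adj k G) r /\
  (forall u v : G, admissible u v -> ~~ adj u v ->
     has_K (add_edge (@adj k G) u v) r).

Definition balanced G (n : nat) := forall i : 'I_k, #|part_set G i| = n.

Definition transversal G (X : {set G}) :=
  #|X| = k /\ forall i : 'I_k, #|X :&: part_set G i| = 1.
End PartiteGraphs.

(* The value 0 for an empty predicate is never used: see [sat_spec] and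
   [alpha_spec]. *)
Definition min_nat (P : nat -> Prop) : nat :=
  if pselect (exists m, `[< P m >]) is left exP then ex_minn exP else 0.

Definition sat_size (n k r m : nat) : Prop :=
  exists G : kgraph k,
    [/\ balanced G n, partite_saturated G r & #|edges (@adj k G)| = m].

Definition sat (n k r : nat) : nat := min_nat (sat_size n k r).

Definition alpha_size (k r m : nat) : Prop :=
  exists (G : kgraph k) (X : {set G}),
    [/\ partite_saturated G r, independent (@adj k G) X, transversal X
      & #|cut_edges (@adj k G) X| = m].

Definition alpha (k r : nat) : nat := min_nat (alpha_size k r).

Definition is_min_nat (P : nat -> Prop) (m : nat) : Prop :=
  P m /\ forall m', P m' -> m <= m'.

Lemma min_natP (P : nat -> Prop) : (exists m, P m) -> is_min_nat P (min_nat P).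
Proof.
move=> [m0 Pm0]; rewrite /min_nat; case: pselect => [exP|]; last first.
  by case; exists m0; apply/asboolP.
case: ex_minnP => m /asboolP Pm lem; split=> // m' /asboolP; exact: lem.
Qed.

Lemma cliqueP (V : finType) (e : rel V) (A : {set V}) :
  reflect (forall u v, u \in A -> v \in A -> u != v -> e u v) (clique e A).
Proof.
apply: (iffP forall_inP) => [cl u v uA vA uv|cl u uA].
  by have /forall_inP /(_ v vA) /implyP := cl u uA; apply.
by apply/forall_inP => v vA; apply/implyP; exact: cl.
Qed.

Lemma saturate (k r : nat) (G : kgraph k) : ~~ has_K (@adj k G) r ->
  exists e : rel G, exists (es : symmetric e)
    (ep : forall u v, e u v -> part u != part v),
    subrel (@adj k G) e /\ partite_saturated (KGraph es ep) r.
Proof.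
case: G => V p e0 es0 ep0 /= nK0.
have [m] := ubnP #|[set q : V * V | ~~ e0 q.1 q.2]|.
elim: m => // m IH in e0 es0 ep0 nK0 *; rewrite ltnS => lem.
have [[u [v [uv nuv nK]]]|noext] := pselect (exists u v,
    [/\ p u != p v, ~~ e0 u v & ~~ has_K (add_edge e0 u v) r]); last first.
  exists e0, es0, ep0; split=> //; split=> // u v uv nuv.
  by apply: contraT => nK; case: noext; exists u, v.
have es1 : symmetric (add_edge e0 u v).
  by move=> x y; rewrite /add_edge es0 orbC [in RHS]orbC; congr (_ || _);
     rewrite orbC; congr (_ || _); rewrite andbC.
have ep1 x y : add_edge e0 u v x y -> p x != p y.
  case/or3P => [/ep0 //|/andP[/eqP-> /eqP->] //|/andP[/eqP-> /eqP->]].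
  by rewrite eq_sym.
have [|e [es [ep [sub sat]]]] := IH _ es1 ep1 nK.
  apply: leq_trans lem; apply: proper_card; apply/properP; split.
    by apply/fintype.subsetP => q; rewrite !inE /add_edge negb_or => /andP[].
  by exists (u, v); rewrite !inE //= /add_edge !eqxx orbT.
exists e, es, ep; split=> // x y xy; apply: sub.
by rewrite /add_edge xy.
Qed.

Lemma sat_spec (n k r : nat) : 1 < r -> is_min_nat (sat_size n k r) (sat n k r).
Proof.
move=> r1; apply: min_natP.
pose e0 : rel ('I_k * 'I_n)%type := fun _ _ => false.
have es0 : symmetric e0 by [].
have ep0 u v : e0 u v -> u.1 != v.1 by [].
have nK : ~~ has_K (@adj k (KGraph es0 ep0)) r.
  apply/existsPn => A; apply/negP => /andP[/eqP cA /cliqueP cl].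
  move: r1; rewrite -cA => /card_gt1P[u [v [uA vA uv]]].
  by have := cl u v uA vA uv.
have [e [es [ep [_ sate]]]] := saturate nK.
exists #|edges e|, (KGraph es ep); split=> // i.
have -> : part_set (KGraph es ep) i = (pair i) @: [set: 'I_n].
  apply/setP => -[j l]; rewrite inE /=; apply/eqP/imsetP => [<-|[l' _ [-> //]]].
  by exists l; rewrite ?in_setT.
by rewrite card_imset ?cardsT ?card_ord // => x y [].
Qed.

Lemma alpha_spec (k r : nat) : 2 < r -> r <= k ->
  is_min_nat (alpha_size k r) (alpha k r).
Proof.
move=> r2 rk; apply: min_natP.
pose T (i j : 'I_k) := [set x in take (r - 2) (enum (~: [set i; j]))].
have Tsub i j x : x \in T i j -> (x != i) && (x != j).
  rewrite inE => /mem_take; rewrite mem_enum !inE negb_or //.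
have cT i j : i != j -> #|T i j| = r - 2.
  move=> ij; rewrite cardsE (card_uniqP _) ?take_uniq ?enum_uniq //.
  rewrite size_takel // -cardE cardsCs finset.setCK cards2 ij card_ord.
  exact: leq_sub2r.
have cTle i j : #|T i j| <= r - 2.
  rewrite cardsE (leq_trans (card_size _)) // size_take_min geq_minl //.
pose V : finType := ('I_k + ('I_k * 'I_k) * 'I_k)%type.
pose p (v : V) : 'I_k := match v with inl i => i | inr q => q.2 end.
pose h (a : 'I_k) (q : ('I_k * 'I_k) * 'I_k) :=
  [&& (a == q.1.1) || (a == q.1.2) & q.2 \in T q.1.1 q.1.2].
pose e0 : rel V := fun u v => match u, v with
  | inl _, inl _ => false
  | inl a, inr q => h a q
  | inr q, inl a => h a q
  | inr q, inr q' => [&& q.1 == q'.1, q.2 != q'.2, q.2 \in T q.1.1 q.1.2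
                        & q'.2 \in T q.1.1 q.1.2]
  end.
have es0 : symmetric e0.
  move=> [a|[ij l]] [b|[ij' l']] //=; rewrite eq_sym [l == _]eq_sym.
  by case: eqP => //= ->; congr (_ && _); rewrite andbC.
have ha a q : h a q -> a != q.2.
  by case/andP => /orP[] /eqP-> /Tsub /andP[? ?]; rewrite eq_sym.
have ep0 u v : e0 u v -> p u != p v.
  move: u v => [a|q] [b|q'] //=; first exact: ha.
  - by rewrite eq_sym; exact: ha.
  - by case/and4P.
have nK : ~~ has_K (@adj k (KGraph es0 ep0)) r.
  apply/existsPn => A; apply/negP => /andP[/eqP cA /cliqueP /= cl].
  have c1 : #|A :&: [set v : V | if v is inl _ then true else false]| <= 1.
    rewrite leqNgt; apply/negP => /card_gt1P[u [v []]].
    rewrite !inE => /andP[uA] ui /andP[vA] vi uv.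
    by have := cl u v uA vA uv; case: u v ui vi {uA vA uv} => [?|?] [].
  suff c2 : #|A :\: [set v : V | if v is inl _ then true else false]| <= r - 2.
    have := leq_add c1 c2; rewrite cardsID cA.
    by case: (r) r2 => [|[|r']] // _; rewrite !subSS subn0 add1n ltnn.
  set B := A :\: _.
  have [B0|[b bB]] := set_0Vmem B; first by rewrite B0 cards0.
  have [b' b'A bb'] : exists2 b', b' \in A & b != b'.
    have : 1 < #|A| by rewrite cA ltnW.
    case/card_gt1P => u [v [uA vA uv]].
    have [bu|] := eqVneq b u; last by exists u.
    by exists v; rewrite // bu.
  move: bB; rewrite !inE; case: b bb' => // -[[i j] l] bb' /= bA.
  have lT : l \in T i j.
    have := cl _ _ bA b'A bb'.
    by case: b' {b'A bb'} => [a /andP[]|q /and4P[]].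
  apply: leq_trans (cTle i j).
  rewrite -(card_imset _ (f := fun x => inr ((i, j), x) : V)); last by move=> x y [].
  apply: subset_leq_card; apply/fintype.subsetP => -[a|[ij' l']]; rewrite !inE //= => cA'.
  have [[<- <-]|ne] := eqVneq (inr (i, j, l) : V) (inr (ij', l')); first exact: imset_f.
  by have /and4P[/= /eqP <- _ _ ?] := cl _ _ bA cA' ne; exact: imset_f.
have [e [es [ep [sub [nKe sate]]]]] := saturate nK.
pose G := KGraph es ep; pose X : {set V} := inl @: [set: 'I_k].
exists #|cut_edges e X|, G, X; split=> //.
- apply/forall_inP => u /imsetP[i _ ->]; apply/forall_inP => v /imsetP[j _ ->].
  apply/negP => eij; have ij : i != j := ep _ _ eij.
  move/existsP: nKe; apply.
  pose Q : {set V} := (fun x => inr ((i, j), x)) @: T i j.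
  have nQ a : inl a \notin Q by apply/negP => /imsetP[].
  have iT a x : ((a == i) || (a == j)) -> x \in T i j ->
      e (inl a) (inr ((i, j), x)).
    by move=> aij xT; apply: sub; rewrite /= /h aij xT.
  exists (inl i |: (inl j |: Q)); apply/andP; split.
    rewrite !cardsU1 !inE !negb_or !nQ !andbT card_imset; last by move=> x y [].
    have -> : ((inl i : V) != inl j) by apply: contra ij => /eqP[->].
    by rewrite cT // addnA subnKC // ltnW.
  apply/cliqueP => x y; rewrite !inE.
  case/or3P => [/eqP->|/eqP->|/imsetP[s sT ->]];
    case/or3P => [/eqP->|/eqP->|/imsetP[t tT ->]] ne //=.
  + by rewrite eqxx in ne.
  + by apply: iT => //; rewrite eqxx.
  + by rewrite es.
  + by rewrite eqxx in ne.
  + by apply: iT => //; rewrite eqxx orbT.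
  + by rewrite es; apply: iT => //; rewrite eqxx.
  + by rewrite es; apply: iT => //; rewrite eqxx orbT.
  + by apply: sub; rewrite /= eqxx sT tT !andbT; apply: contraNneq ne => ->.
- split; first by rewrite card_imset ?cardsT ?card_ord // => x y [].
  move=> i; suff -> : X :&: part_set G i = [set inl i] by rewrite cards1.
  apply/setP => v; rewrite !inE; apply/andP/eqP => [[/imsetP[j _ ->] /= /eqP->] //|->].
  by rewrite eqxx imset_f.
Qed.

(* Main.v *)
Require Import Defs.
From mathcomp Require Import all_boot all_order all_algebra.
From mathcomp Require Import boolp classical_sets functions reals topology normedtype landau.
From mathcomp Require Import zify lra.
Import Order.TTheory GRing.Theory Num.Theory.
Import numFieldNormedType.Exports.
Set Implicit Arguments.
Unset Strict Implicit.
Unset Printing Implicit Defensive.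

(** Upper bound: let (G, X) attain alpha(k, r). Blowing up each vertex of X into
    copies until every part has n vertices keeps the graph saturated, and all but
    O(1) of its edges are the at most alpha(k, r) n edges at copies of X.

    Lower bound: let G be an extremal balanced graph, fix D, and let B be the set
    of the O(n / D) vertices of degree greater than D. If x_1y_1, ..., x_my_m are
    edges outside B, with the x_i in one part, the y_j in another and x_iy_j a
    non-edge for i <> j, then saturation gives a K_(r-2) in the common
    neighbourhood of x_i and y_j for i <> j, while there is none for i = j. By
    Bollobas' set-pair argument, applied to the sets of K_(r-2)'s in the
    neighbourhoods, m is bounded in terms of D. So boundedly many vertices C cover
    all edges outside B, and the complement U of B and C is independent. Choosing
    in each part a vertex of U of least degree gives an independent transversal,
    with degree sum at least alpha(k, r); summing degrees over U bounds the number
    of edges below by alpha(k, r) (n - |B| - |C|). *)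

(** * Bollobás' set-pair bound *)

Lemma leq_card_bigcup (I T : finType) (P : pred I) (F : I -> {set T}) :
  #|\bigcup_(i | P i) F i| <= \sum_(i | P i) #|F i|.
Proof.
elim/big_rec2: _ => [|i m A _ IH]; first by rewrite cards0.
by rewrite (leq_trans (leq_card_setU _ _)) // leq_add2l.
Qed.

(* Each b j with j <> i meets a i, so at least (|S| - 1) / d of them share a point
   p of a i; deleting p from these b j preserves the hypotheses and decreases e. *)
Lemma set_pairs_le (I T : finType) (a b : I -> {set T}) (S : {set I})
    (d e : nat) :
  {in S, forall i, #|a i| <= d} -> {in S, forall i, #|b i| <= e} ->
  {in S, forall i, [disjoint a i & b i]} ->
  {in S &, forall i j, i != j -> ~~ [disjoint a i & b j]} ->
  #|S| <= d.+1 ^ e.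
Proof.
elim: e b S => [|e IH] b S ad be dis cross.
  rewrite expn0 leqNgt; apply/negP => /card_gt1P[i [j [iS jS ij]]].
  have := cross i j iS jS ij; have /eqP : #|b j| == 0 by rewrite -leqn0 be.
  by move/cards0_eq ->; rewrite disjoint_sym finset.disjoints_subset finset.sub0set.
have [->|[i0 i0S]] := set_0Vmem S; first by rewrite cards0.
pose S_ p := [set j in S | p \in b j].
have S_le p : #|S_ p| <= d.+1 ^ e.
  apply: (IH (fun j => b j :\ p)) => [i|i|i|i j]; rewrite !inE.
  - by case/andP => iS _; exact: ad.
  - by case/andP => iS pb; have := be i iS; rewrite (cardsD1 p) pb.
  - case/andP => iS _; apply: fintype.disjointWr (dis i iS); exact: subD1set.
  case/andP => iS pbi /andP[jS _] ij.
  have /pred0Pn[q /= /andP[qa qb]] := cross i j iS jS ij.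
  apply/pred0Pn; exists q; rewrite /= !inE qa qb andbT.
  apply/eqP => qp; move: (dis i iS); rewrite finset.disjoints_subset.
  by move/fintype.subsetP => /(_ q qa); rewrite inE qp pbi.
have /subset_leq_card : S \subset i0 |: \bigcup_(p in a i0) S_ p.
  apply/fintype.subsetP => j jS; rewrite !inE; have [//|ji] := eqVneq j i0.
  rewrite eq_sym in ji.
  have /pred0Pn[q /= /andP[qa qb]] := cross i0 j i0S jS ji.
  by apply/bigcupP; exists q; rewrite ?inE ?jS.
(* This uses $1 + d(d+1)^e \le (d+1)^{e+1}$, the 1 counting [i0]. *)
move/leq_trans; apply; rewrite cardsU1 expnS mulSn leq_add //.
  by case: (_ \notin _); rewrite ?expn_gt0.
apply: leq_trans (_ : \sum_(p in a i0) d.+1 ^ e <= _).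
  by apply: leq_trans (leq_card_bigcup _ _) _; exact: leq_sum.
by rewrite sum_nat_const leq_mul2r ad ?orbT.
Qed.

(** * Cliques in common neighbourhoods *)

Definition nbr_cliques (V : finType) (e : rel V) (s : nat) (u : V) :=
  [set Q : {set V} | [&& #|Q| == s, clique e Q & [forall q in Q, e u q]]].

Lemma card_nbr_cliques (V : finType) (e : rel V) (s : nat) (u : V) :
  #|nbr_cliques e s u| <= 2 ^ #|e u|.
Proof.
rewrite -(cardsE (e u)) -card_powerset; apply/subset_leq_card.
apply/fintype.subsetP => Q; rewrite !inE => /and3P[_ _ /forall_inP Qu].
by apply/fintype.subsetP => q /Qu; rewrite inE.
Qed.

(** Hence without a $K_{s+2}$ the families of two adjacent vertices are disjoint: the diagonal
    condition on set pairs. *)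
Lemma nbr_cliques_has_K (V : finType) (e : rel V) (s : nat) (u v : V)
    (Q : {set V}) : symmetric e -> irreflexive e -> e u v ->
  Q \in nbr_cliques e s u -> Q \in nbr_cliques e s v -> has_K e s.+2.
Proof.
move=> es ei euv; rewrite !inE => /and3P[/eqP cQ /cliqueP cl /forall_inP Qu].
case/and3P => _ _ /forall_inP Qv; apply/existsP; exists (u |: (v |: Q)).
apply/andP; split.
  have uv : u != v by apply: contraTneq euv => ->; rewrite ei.
  have uQ : u \notin Q by apply/negP => /Qu; rewrite ei.
  have vQ : v \notin Q by apply/negP => /Qv; rewrite ei.
  by rewrite !cardsU1 !inE negb_or uv uQ vQ cQ.
apply/cliqueP => x y; rewrite !inE.
case/or3P => [/eqP->|/eqP->|xQ]; case/or3P => [/eqP->|/eqP->|yQ];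
  rewrite ?eqxx // => ne; first [exact: Qu | exact: Qv | idtac].
- by rewrite es.
- by rewrite es; exact: Qu.
- by rewrite es; exact: Qv.
exact: cl.
Qed.

(** The new clique must use the added edge; removing both ends of it leaves a clique in both
    neighbourhoods. This is the crossing condition on set pairs. *)
Lemma add_edge_nbr_cliques (V : finType) (e : rel V) (s : nat) (u v : V) :
  symmetric e -> u != v -> ~~ has_K e s.+2 -> has_K (add_edge e u v) s.+2 ->
  ~~ [disjoint nbr_cliques e s u & nbr_cliques e s v].
Proof.
move=> es uv nK /existsP[A /andP[/eqP cA /cliqueP cl]].
have clA x y : x \in A -> y \in A -> x != y ->
    ~~ ((x == u) && (y == v) || (x == v) && (y == u)) -> e x y.
  move=> xA yA xy /negbTE ne.
  by move: (cl x y xA yA xy); rewrite /add_edge ne orbF.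
have [uA vA] : u \in A /\ v \in A.
  apply/andP; move: nK; apply: contraNT => nA; apply/existsP; exists A.
  rewrite cA eqxx /=; apply/cliqueP => x y xA yA xy; apply: clA => //.
  by apply: contra nA => /orP[] /andP[/eqP<- /eqP<-]; rewrite xA yA.
apply/pred0Pn; exists (A :\ u :\ v) => /=.
have cQ : #|A :\ u :\ v| = s.
  have := cardsD1 u A; have := cardsD1 v (A :\ u).
  by rewrite cA uA !inE eq_sym uv vA /= !add1n => -> [].
have clQ : clique e (A :\ u :\ v).
  apply/cliqueP => x y; rewrite !inE => /and3P[xv xu xA] /and3P[yv yu yA] xy.
  by apply: clA => //; rewrite (negbTE xv) (negbTE xu).
rewrite !inE cQ clQ eqxx /=; apply/andP; split; apply/forall_inP => q;
  rewrite !inE => /and3P[qv qu qA]; apply: clA => //;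
  by rewrite ?(negbTE qv) ?(negbTE qu) ?andbF // eq_sym.
Qed.

(** * Covering the edges between low-degree vertices *)

Lemma adjxx (k : nat) (G : kgraph k) : irreflexive (@adj k G).
Proof. by move=> u; apply/negP => /adj_part; rewrite eqxx. Qed.

(** The set-pair bound for families of at most $2^D$ cliques, times the at most $2D$ neighbours of
    the two ends of an edge. *)
Definition cover_bound (D : nat) := (2 ^ D).+1 ^ (2 ^ D) * (D + D).

(* C is the neighbourhood of a maximal family of edges as in the set-pair argument. *)
Lemma low_degree_cover_parts (k s D : nat) (G : kgraph k) (p q : 'I_k) :
  partite_saturated G s.+2 ->
  exists C : {set G}, #|C| <= cover_bound D /\
    forall u v : G, part u = p -> part v = q -> adj u v ->
      #|adj u| <= D -> #|adj v| <= D -> (u \in C) || (v \in C).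
Proof.
move=> [nK sat_G]; pose E (x : G * G) :=
  [&& part x.1 == p, part x.2 == q, adj x.1 x.2, #|adj x.1| <= D
    & #|adj x.2| <= D].
pose P (S : {set G * G}) := [forall x in S, E x] &&
  [forall x in S, forall y in S, (x != y) ==> ~~ adj x.1 y.2].
have PP (S : {set G * G}) : reflect ({in S, forall x, E x} /\
    {in S &, forall x y, x != y -> ~~ adj x.1 y.2}) (P S).
  apply: (iffP andP) => -[/forall_inP H1 H2]; split=> //.
    move=> x y xS yS; move/forall_inP: H2 => /(_ x xS) /forall_inP /(_ y yS).
    exact: implyP.
  apply/forall_inP => x xS; apply/forall_inP => y yS; apply/implyP; exact: H2.
have P0 : P finset.set0 by apply/PP; split=> x; rewrite inE.
have [S /maxsetP[/PP[SE Sind] Smax] _] := maxset_exists P0.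
pose N (x : G * G) := [set v | adj x.1 v] :|: [set v | adj x.2 v].
exists (\bigcup_(x in S) N x); split.
  have cS : #|S| <= (2 ^ D).+1 ^ (2 ^ D).
    apply: (@set_pairs_le _ _ (fun x => nbr_cliques (@adj k G) s x.1)
                              (fun x => nbr_cliques (@adj k G) s x.2)).
    - move=> x /SE/and5P[_ _ _ d1 _].
      by rewrite (leq_trans (card_nbr_cliques _ _ _)) // leq_exp2l.
    - move=> x /SE/and5P[_ _ _ _ d2].
      by rewrite (leq_trans (card_nbr_cliques _ _ _)) // leq_exp2l.
    - move=> x /SE/and5P[_ _ xx _ _]; apply/pred0P => Q /=.
      apply/negP => /andP[Q1 Q2]; move/negP: nK; apply.
      exact: nbr_cliques_has_K (@adj_sym _ G) (@adjxx _ G) xx Q1 Q2.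
    move=> x y xS yS xy.
    have /and5P[/eqP x1 /eqP x2 xx _ _] := SE x xS.
    have /and5P[_ /eqP y2 _ _ _] := SE y yS.
    (* Fixing the parts makes every cross pair admissible: $p \ne q$ because [x] is an edge. *)
    have adm : part x.1 != part y.2 by rewrite y2 -x2 adj_part.
    apply: add_edge_nbr_cliques => //; first exact: adj_sym.
      by apply: contra adm => /eqP->.
    by apply: sat_G => //; exact: Sind.
  apply: leq_trans (leq_mul cS (leqnn _)); rewrite -sum_nat_const.
  apply: leq_trans (leq_card_bigcup _ _) _.
  apply: leq_sum => x /SE/and5P[_ _ _ d1 d2].
  by rewrite (leq_trans (leq_card_setU _ _)) // !cardsE leq_add.
move=> u v pu qv uv du dv; rewrite -[_ || _]negbK negb_or.
apply/negP => /andP[/bigcupP uC /bigcupP vC].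
(* If [C] misses both ends, neither is adjacent to an end of an edge in [S], so maximality puts
   [(u, v)] in [S]; but then [C] contains [v], a neighbour of [u]. *)
have uvS : (u, v) \in S.
  suff /Smax <- : P ((u, v) |: S) by rewrite ?inE ?eqxx // finset.subsetUr.
  apply/PP; split=> [x|x y]; rewrite !inE.
    by case/orP => [/eqP->|/SE //]; rewrite /E /= pu qv uv du dv !eqxx.
  case/orP => [/eqP->|xS]; case/orP => [/eqP->|yS]; rewrite ?eqxx //.
  - move=> _; apply/negP => /= a; apply: uC; exists y => //.
    by rewrite !inE [adj y.2 u]adj_sym a orbT.
  - by move=> _; apply/negP => /= a; apply: vC; exists x; rewrite // !inE a.
  - exact: Sind.
by apply: vC; exists (u, v); rewrite // !inE uv.
Qed.

(** * Edge counts and degree sums *)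

Lemma card_cut_edges (V : finType) (e : rel V) (X : {set V}) :
  symmetric e -> independent e X -> #|cut_edges e X| = \sum_(u in X) #|e u|.
Proof.
move=> es /forall_inP ind; pose P := [set p : V * V | (p.1 \in X) && e p.1 p.2].
have notX p : p \in P -> p.2 \notin X.
  rewrite inE => /andP[pX ep]; apply/negP => p2X.
  by move/forall_inP: (ind _ pX) => /(_ _ p2X); rewrite ep.
transitivity #|P|; last first.
  rewrite -sum1_card.
  under [RHS]eq_bigr => u _ do rewrite -sum1_card.
  by rewrite pair_big_dep; apply: eq_bigl => p; rewrite !inE.
have -> : cut_edges e X = [set [set p.1; p.2] | p in P].
  apply/setP => E; rewrite inE; apply/andP/imsetP.
    case=> /imsetP[[u v]]; rewrite inE /= => euv -> /andP[/set0Pn[x]] /[swap] /set0Pn[y].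
    rewrite !inE => /andP[yuv yX] /andP[xuv xX].
    case/orP: yuv yX => /eqP->; case/orP: xuv xX => /eqP-> xX yX.
    - by rewrite xX in yX.
    - by exists (v, u); [rewrite inE /= xX es | rewrite finset.setUC].
    - by exists (u, v); [rewrite inE /= xX |].
    - by rewrite xX in yX.
  case=> p pP ->; have p2 := notX _ pP.
  have /andP[p1 ep] : (p.1 \in X) && e p.1 p.2 by move: pP; rewrite inE.
  split; first by apply/imsetP; exists p; rewrite ?inE.
  apply/andP; split; apply/set0Pn; [exists p.1 | exists p.2];
    by rewrite !inE eqxx ?orbT.
(* Only the first entry of a pair in [P] lies in [X], so the unordered edge determines the pair. *)
apply: card_in_imset => -[u v] [u' v'] uP uP' /= E.
have vX := notX _ uP; have vX' := notX _ uP'.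
move: uP uP' vX vX'; rewrite !inE /= => /andP[uX _] /andP[uX' _] vX vX'.
have : u \in [set u'; v'] by rewrite -E !inE eqxx.
have : v \in [set u'; v'] by rewrite -E !inE eqxx orbT.
rewrite !inE => /orP[/eqP vu|/eqP->]; first by rewrite vu uX' in vX.
by case/orP=> [/eqP->//|/eqP uv]; rewrite -uv uX in vX'.
Qed.

Lemma sum_degrees_le (k : nat) (G : kgraph k) :
  \sum_(u : G) #|adj u| <= 2 * #|edges (@adj k G)|.
Proof.
pose P := [set p : G * G | adj p.1 p.2].
(* The Boolean separates the two orientations of an edge, as its ends lie in different parts. *)
pose f (p : G * G) := ([set p.1; p.2], part p.1 < part p.2).
have -> : \sum_(u : G) #|adj u| = #|P|.
  rewrite -sum1_card.
  under [LHS]eq_bigr => u _ do rewrite -sum1_card.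
  by rewrite pair_big_dep; apply: eq_bigl => p; rewrite !inE.
have f_inj : {in P &, injective f}.
  move=> [u v] [u' v']; rewrite !inE /= => uv uv' [E L].
  have : u \in [set u'; v'] by rewrite -E !inE eqxx.
  have : v \in [set u'; v'] by rewrite -E !inE eqxx orbT.
  have := adj_part uv; rewrite -(inj_eq val_inj) /=.
  rewrite !inE => ne /orP[] /eqP vE /orP[] /eqP uE; move: ne L;
    rewrite vE uE ?eqxx // neq_ltn.
  by case: ltngtP.
rewrite -(card_in_imset f_inj) mulnC.
have -> : #|edges (@adj k G)| * 2 = #|finset.setX (edges (@adj k G)) [set: bool]|.
  by rewrite cardsX cardsT card_bool.
apply/subset_leq_card/fintype.subsetP => _ /imsetP[p + ->].
by rewrite !inE andbT => pP; apply/imsetP; exists p; rewrite ?inE.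
Qed.

(** * Blow-ups and the upper bound *)

Definition pullback (k : nat) (G : kgraph k) (W : finType) (f : W -> G) :=
  @KGraph k W (@part k G \o f) (relpre f (@adj k G))
    (fun u v => adj_sym (f u) (f v)) (fun u v => @adj_part k G (f u) (f v)).

(** Fibres of [f] are independent, so cliques map injectively to cliques of [G]; conversely, a
    clique created in [G] lifts along a section of [f]. *)
Lemma pullback_saturated (k r : nat) (G : kgraph k) (W : finType) (f : W -> G) :
  (forall x, exists w, f w = x) -> partite_saturated G r ->
  partite_saturated (pullback f) r.
Proof.
move=> /fin_all_exists[g gK] [nK sat_G]; split.
  apply: contra nK => /existsP[A /andP[/eqP cA /cliqueP cl]].
  have f_inj : {in A &, injective f}.
    move=> x y xA yA fxy; apply/eqP; apply: contraT => xy.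
    by have := cl x y xA yA xy; rewrite /= fxy adjxx.
  apply/existsP; exists (f @: A); rewrite card_in_imset // cA eqxx /=.
  apply/cliqueP => _ _ /imsetP[x xA ->] /imsetP[y yA ->] fxy.
  by apply: cl => //; apply: contra fxy => /eqP->.
move=> u v; rewrite /admissible /= => uv nuv.
have /existsP[A /andP[/eqP cA /cliqueP cl]] := sat_G _ _ uv nuv.
have fuv : f v != f u by rewrite eq_sym; apply: contra uv => /eqP->.
(* A section of [f] through [u] and [v], so that the added edge lifts to [uv] itself. *)
pose h x := if x == f u then u else if x == f v then v else g x.
have hK x : f (h x) = x by rewrite /h; do 2 case: eqP => // _.
apply/existsP; exists (h @: A); rewrite card_imset ?cA ?eqxx /=; last first.
  exact: can_inj hK.
apply/cliqueP => _ _ /imsetP[x xA ->] /imsetP[y yA ->] hxy.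
have xy : x != y by apply: contra hxy => /eqP->.
have := cl x y xA yA xy; rewrite /add_edge /= !hK.
case/or3P => [->//|/andP[/eqP-> /eqP->]|/andP[/eqP-> /eqP->]];
  by rewrite /h !eqxx (negbTE fuv) !eqxx !orbT.
Qed.

Lemma sat_le (k r : nat) : 2 < r -> r <= k ->
  exists c, forall n, c < n -> sat n k r <= alpha k r * n + c * c.
Proof.
move=> r2 rk; have [[G [X [satG indX [cX X1] cutX]]] _] := alpha_spec r2 rk.
exists #|G| => n ltn.
have /fin_all_exists[x xP] : forall i, exists x, X :&: part_set G i = [set x].
  by move=> i; apply/cards1P; rewrite X1.
have xX i : (x i \in X) && (part (x i) == i).
  have : x i \in X :&: part_set G i by rewrite xP !inE.
  by rewrite !inE.
pose s i := enum (part_set G i :\: X).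
have ms i v : (v \in s i) = (v \notin X) && (part v == i).
  by rewrite mem_enum !inE.
(* By the choice of the default value, f is injective off the preimage of X,
   and the remaining elements of the i-th row are sent to x i. *)
pose f (w : 'I_k * 'I_n) := nth (x w.1) (s w.1) w.2.
have fE w : f w = x w.1 \/ f w \in s w.1.
  have [lt|ge] := ltnP w.2 (size (s w.1)); first by right; exact: mem_nth.
  by left; rewrite /f nth_default.
have part_f w : part (f w) = w.1.
  by have [->|] := fE w; [have /andP[_ /eqP] := xX w.1
                         | rewrite ms => /andP[_ /eqP]].
have f_inj : {in [pred w | f w \notin X] &, injective f}.
  have f_lt w : f w \notin X -> w.2 < size (s w.1).
    move=> fX; rewrite ltnNge; apply: contra fX => ge.
    by rewrite /f nth_default //; have /andP[] := xX w.1.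
  move=> [i j] [i' j']; rewrite !inE => /f_lt lt /f_lt lt' fE'.
  have := part_f (i, j); rewrite fE' part_f /= => ii'; subst i'.
  congr pair; apply/val_inj/eqP.
  by rewrite -(nth_uniq (x i) lt lt' (enum_uniq _)); apply/eqP.
have f_surj v : exists w, f w = v.
  (* Strictness leaves the index [size (s i)] free for a copy of [x i]. *)
  have s_lt i : size (s i) < n.
    by apply: leq_ltn_trans ltn; rewrite -cardE max_card.
  have [vX|vX] := boolP (v \in X).
    exists (part v, Ordinal (s_lt (part v))); rewrite /f nth_default //=.
    by apply/esym/set1P; rewrite -xP !inE vX /=.
  have vs : v \in s (part v) by rewrite ms vX eqxx.
  have lt : index v (s (part v)) < n.
    by rewrite (leq_trans _ (ltnW (s_lt (part v)))) // index_mem.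
  by exists (part v, Ordinal lt); rewrite /f /= nth_index.
pose W := [set w | f w \in X]; pose H := pullback f.
have indW : independent (@adj k H) W.
  apply/forall_inP => u; rewrite inE => uW; apply/forall_inP => v.
  by rewrite inE => vW; move/forall_inP: indX => /(_ _ uW) /forall_inP /(_ _ vW).
have balH : balanced H n.
  move=> i; have -> : part_set H i = (pair i) @: [set: 'I_n].
    apply/setP => -[j l]; rewrite inE /= part_f.
    apply/eqP/imsetP => /= [<-|[l' _ [-> //]]].
    by exists l; rewrite ?finset.in_setT.
  by rewrite card_imset ?cardsT ?card_ord // => u v [].
have [_ /(_ _ (ex_intro _ H (And3 balH (pullback_saturated f_surj satG) erefl)))] :=
  sat_spec n k (ltnW r2).
move/leq_trans; apply.
(* As [W] is independent, an edge is either cut by [W] or has both ends outside [W]; the latter give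
   the term $c^2$. *)
have /subset_leq_card : edges (@adj k H) \subset cut_edges (@adj k H) W
    :|: [set [set p.1; p.2] | p in finset.setX (~: W) (~: W)].
  apply/fintype.subsetP => E /imsetP[[u v]]; rewrite inE /= => uv ->.
  rewrite !inE; apply/orP; have [uW|uW] := boolP (u \in W); last first.
    have [vW|vW] := boolP (v \in W); last first.
      right; apply/imsetP; exists (u, v) => //.
      by rewrite inE /= !finset.in_setC uW vW.
    left; apply/andP; split; first by apply/imsetP; exists (u, v); rewrite ?inE.
    apply/andP; split; apply/set0Pn; [exists v | exists u];
      by rewrite finset.in_setI ?finset.in_setC ?uW ?vW !inE eqxx ?orbT.
  have vW : v \notin W.
    move/forall_inP: indW => /(_ _ uW) /forall_inP h; apply/negP => /h.
    by rewrite /= uv.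
  left; apply/andP; split; first by apply/imsetP; exists (u, v); rewrite ?inE.
  apply/andP; split; apply/set0Pn; [exists u | exists v];
    by rewrite finset.in_setI ?finset.in_setC ?uW ?vW !inE eqxx ?orbT.
move/leq_trans; apply; apply: leq_trans (leq_card_setU _ _) _.
apply: leq_add; last first.
  apply: leq_trans (leq_imset_card _ _) _; rewrite cardsX.
  suff cW : #|~: W| <= #|G| by exact: leq_mul.
  rewrite -(card_in_imset (f := f)) ?max_card // => u v; rewrite !inE.
  exact: f_inj.
rewrite card_cut_edges //; last exact: (@adj_sym k H).
(* Neighbours of [w] lie outside [W], where [f] is injective, so blowing up does not raise the
   degree of [w]. *)
apply: leq_trans (_ : \sum_(w in W) #|adj (f w)| <= _).
  apply: leq_sum => w; rewrite inE => wX; rewrite -(cardsE (@adj k H w)).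
  rewrite -(cardsE (adj (f w))).
  rewrite -(card_in_imset (f := f)).
    apply/subset_leq_card/fintype.subsetP => _ /imsetP[v + ->].
    by rewrite !inE.
  have nX v : adj (f w) (f v) -> f v \notin X.
    move=> wv; apply/negP => vX; move/forall_inP: indX => /(_ _ wX).
    by move=> /forall_inP /(_ _ vX); rewrite wv.
  by move=> u v; rewrite !inE => /nX uX /nX vX; exact: f_inj.
(* Each [y] in [X] has at most [n] copies, since they all lie in one part. *)
rewrite (partition_big f [in X]) => [|w]; last by rewrite inE.
rewrite -cutX card_cut_edges //; last exact: adj_sym.
rewrite big_distrl /=; apply: leq_sum => y yX.
rewrite (eq_bigr (fun=> #|adj y|)) => [|w /andP[_ /eqP->] //].
rewrite sum_nat_const mulnC leq_mul2l; apply/orP; right.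
rewrite -[X in _ <= X]card_ord -(card_in_imset (f := snd)) ?max_card //.
move=> [i j] [i' j'] /andP[_ /eqP yE] /andP[_ /eqP yE'] /= ->.
by have := part_f (i, j); rewrite yE -yE' part_f /= => ->.
Qed.

(** * Lower bound *)

Lemma low_degree_cover (k s D : nat) (G : kgraph k) :
  partite_saturated G s.+2 ->
  exists C : {set G}, #|C| <= k * k * cover_bound D /\
    forall u v : G, adj u v ->
      #|adj u| <= D -> #|adj v| <= D -> (u \in C) || (v \in C).
Proof.
move=> satG.
have /fin_all_exists[C CP] (pq : 'I_k * 'I_k) :=
  low_degree_cover_parts D pq.1 pq.2 satG.
exists (\bigcup_pq C pq); split; last first.
  move=> u v uv du dv.
  have /orP[uC|vC] := (CP (part u, part v)).2 u v erefl erefl uv du dv;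
    apply/orP; [left | right]; by apply/bigcupP; exists (part u, part v).
apply: leq_trans (leq_card_bigcup _ _) _.
apply: leq_trans (_ : \sum_(pq : 'I_k * 'I_k) cover_bound D <= _).
  by apply: leq_sum => pq _; have [] := CP pq.
by rewrite sum_nat_const card_prod card_ord.
Qed.

Lemma alpha_le_degrees (k r : nat) (G : kgraph k) (x : 'I_k -> G) :
  2 < r -> r <= k -> partite_saturated G r -> (forall i, part (x i) = i) ->
  (forall i j, ~~ adj (x i) (x j)) -> alpha k r <= \sum_i #|adj (x i)|.
Proof.
move=> r2 rk satG xP indx; have [_ min] := alpha_spec r2 rk.
have x_inj : injective x by exact: can_inj xP.
pose X := [set x i | i : 'I_k].
have indX : independent (@adj k G) X.
  apply/forall_inP => _ /imsetP[i _ ->]; apply/forall_inP => _ /imsetP[j _ ->].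
  exact: indx.
have transX : Defs.transversal X.
  split=> [|i]; first by rewrite card_imset ?cardsT ?card_ord.
  suff -> : X :&: part_set G i = [set x i] by rewrite cards1.
  apply/setP => v; rewrite !inE; apply/andP/eqP.
    by case=> /imsetP[j _ ->]; rewrite xP => /eqP->.
  by move->; rewrite xP imset_f.
have : alpha k r <= #|cut_edges (@adj k G) X| by apply: min; exists G, X.
rewrite card_cut_edges //; last exact: adj_sym.
by rewrite big_imset //= => i j _ _; exact: x_inj.
Qed.

(** Here [h] counts the vertices of degree above [D]. The first inequality, from the degree sum,
    gives $h = O(n/D)$ once the linear upper bound on [sat] is known. *)
Lemma sat_ge (k r D n : nat) : 2 < r -> r <= k -> exists2 h,
  D * h <= 2 * sat n k r &
  alpha k r * (n - (h + k * k * cover_bound D)) <= sat n k r.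
Proof.
move=> r2 rk; have [[G [balG satG <-]] _] := sat_spec n k (ltnW r2).
exists #|[set v : G | D < #|adj v|]|.
  apply: leq_trans (sum_degrees_le G); rewrite mulnC -sum_nat_const.
  rewrite [X in _ <= X](bigID [in [set v : G | D < #|adj v|]]) /=.
  apply: leq_trans (leq_addr _ _); apply: leq_sum => v.
  by rewrite inE; exact: ltnW.
set B := [set v : G | _].
have [C [cC coverC]] : exists C : {set G}, #|C| <= k * k * cover_bound D /\
    forall u v : G, adj u v ->
      #|adj u| <= D -> #|adj v| <= D -> (u \in C) || (v \in C).
  by case: r r2 rk satG => [|[|s]] // _ _; exact: low_degree_cover.
pose U := ~: (B :|: C); set m := n - _.
have indU u v : u \in U -> v \in U -> ~~ adj u v.
  rewrite !inE !negb_or -!leqNgt => /andP[du uC] /andP[dv vC].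
  by apply/negP => /coverC /(_ du dv); rewrite (negbTE uC) (negbTE vC).
pose Ui i := U :&: part_set G i.
have cUi i : m <= #|Ui i|.
  have -> : Ui i = part_set G i :\: (B :|: C) by rewrite finset.setDE finset.setIC.
  rewrite cardsD balG leq_sub2l //.
  apply: leq_trans (subset_leq_card (finset.subsetIr _ _)) _.
  by apply: leq_trans (leq_card_setU _ _) _; rewrite leq_add2l.
have [->|m0] := posnP m; first by rewrite muln0.
have /fin_all_exists[x xP] : forall i, exists x, x \in Ui i /\
    forall v, v \in Ui i -> #|adj x| <= #|adj v|.
  move=> i; have /card_gt0P[x0 x0U] : 0 < #|Ui i| by exact: leq_trans (cUi i).
  by case: (@arg_minnP _ x0 [in Ui i] (fun v => #|adj v|)) => // x *; exists x.
have xU i : (x i \in U) && (part (x i) == i).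
  by have [+ _] := xP i; rewrite finset.in_setI [x i \in part_set _ _]inE.
have alpha_le : alpha k r <= \sum_i #|adj (x i)|.
  apply: alpha_le_degrees => // [i|i j]; first by have /andP[_ /eqP] := xU i.
  by apply: indU; [have /andP[] := xU i | have /andP[] := xU j].
have : #|cut_edges (@adj k G) U| <= #|edges (@adj k G)|.
  by apply/subset_leq_card/fintype.subsetP => E; rewrite inE => /andP[].
apply: leq_trans; rewrite card_cut_edges; last 2 first.
- exact: adj_sym.
- by apply/forall_inP => u uU; apply/forall_inP => v; exact: indU.
apply: leq_trans (leq_mul alpha_le (leqnn m)) _.
(* Each part contributes at least [m] vertices of [U], all of degree at least that of [x i]. *)
rewrite (partition_big (@part k G) xpredT) //= big_distrl /=; apply: leq_sum => i _.
apply: leq_trans (_ : #|Ui i| * #|adj (x i)| <= _).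
  by rewrite mulnC leq_mul2r cUi orbT.
rewrite -sum_nat_const [X in _ <= X](eq_bigl [in Ui i]) => [|v]; last by rewrite !inE.
by apply: leq_sum => v; have [_] := xP i; exact.
Qed.

(** * Asymptotics *)

Local Open Scope classical_set_scope.
Local Open Scope ring_scope.

Theorem theorem1p1 (R : realType) (k r : nat) (hr : (3 <= r)%N) (hk : (r <= k)%N) :
  (fun n : nat => (sat n k r)%:R : R) =
    (fun n : nat => (alpha k r)%:R * n%:R : R) +o_\oo (fun n : nat => n%:R : R).
Proof.
(* The final estimate multiplied by [D]: [dx], [dy], [de] become $D\,sat$, $D\alpha n$,
   $D\varepsilon n$, and half of [de] absorbs each of [2w] and [p]. *)
have lin (dx dy de w p z e : R) : 0 <= z -> z + 2%:R * p <= e ->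
    dy <= dx + 2%:R * w + p -> 4%:R * w <= de -> e <= de -> dy - de <= dx.
  by lra.
apply/eqaddoP => eps eps0; set a := alpha k r.
have [c satc] := sat_le hr hk.
(* High-degree vertices cost about $\alpha h \le 2\alpha^2 n/D$, which this choice makes less than
   $\varepsilon n/2$. *)
set D := Num.bound (4%:R * a%:R ^+ 2 / eps : R).
have D0 : 4%:R * a%:R ^+ 2 < eps * D%:R :> R.
  rewrite -ltr_pdivrMl // [X in X < _]mulrC /D archi_boundP //.
  by rewrite divr_ge0 ?mulr_ge0 ?sqr_ge0 // ltW.
have D1 : (0 < D)%N.
  rewrite -(ltr_nat R) -(pmulr_rgt0 _ eps0); apply: le_lt_trans D0.
  by rewrite mulr_ge0 ?sqr_ge0.
set L := (k * k * cover_bound D)%N.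
(* The terms independent of [n] in $D\alpha(h+L) \le 2\alpha(\alpha n + c^2) + D\alpha L$. *)
set P := (2 * a * (c * c) + D * (a * L))%N.
near=> n.
have ltcn : (c < n)%N by near: n; exact: nbhs_infty_gt.
have leP : (c * c)%:R + 2%:R * P%:R <= eps * n%:R :> R.
  rewrite -natrM -natrD -ler_pdivrMl //; apply/ltW.
  apply: lt_le_trans (_ : (Num.bound (eps^-1 * (c * c + 2 * P)%:R))%:R <= _).
    by rewrite archi_boundP // mulr_ge0 // invr_ge0 ltW.
  by rewrite ler_nat; near: n; exact: nbhs_infty_ge.
have hi := satc n ltcn; have [h hD lo] := sat_ge D n hr hk.
rewrite -/a in hi lo; rewrite -/L in lo.
have {}lo : (D * (a * n) <= D * sat n k r + 2 * (a * a * n) + P)%N.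
  have lo' : (a * n <= sat n k r + a * (h + L))%N.
    apply: leq_trans (leq_add lo (leqnn _)).
    by rewrite -mulnDr leq_mul2l addnC -leq_subLR leqnn orbT.
  apply: leq_trans (leq_mul (leqnn D) lo') _.
  rewrite /P mulnDr -addnA leq_add2l mulnDr mulnDr addnA leq_add2r.
  have -> : (2 * (a * a * n) + 2 * a * (c * c) = a * (2 * (a * n + c * c)))%N.
    by clear; lia.
  rewrite mulnCA leq_mul2l (leq_trans hD) ?orbT //.
  by rewrite leq_mul2l hi.
rewrite !fctE /= [`|n%:R|]ger0_norm // ler_distl; apply/andP; split; last first.
  have hiR : (sat n k r)%:R <= a%:R * n%:R + (c * c)%:R :> R.
    by rewrite -natrM -natrD ler_nat.
  apply: le_trans hiR _; rewrite lerD2l; apply: le_trans leP.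
  by rewrite lerDl mulr_ge0.
rewrite -(ler_pM2l (_ : 0 < D%:R :> R)) ?ltr0n // mulrBr.
apply: (lin _ _ _ (a * a * n)%:R P%:R (c * c)%:R (eps * n%:R)) => //.
- by rewrite -!natrM -!natrD ler_nat.
- have := ler_wpM2r (ler0n R n) (ltW D0).
  by rewrite !natrM expr2 [X in _ -> _ <= X]mulrCA !mulrA.
- by rewrite ler_peMl ?ler1n // mulr_ge0 // ltW.
Unshelve. all: by end_near.
Qed.
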